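(* Let $\mathcal{Q}_n$ denote the $n$-dimensional hypercube graph. For a graph $F$, let $\mathrm{ex}_{\mathcal{Q}}(n,F)$ be the maximum number of edges of a subgraph of $\mathcal{Q}_n$ containing no (not necessarily induced) copy of $F$, and let $\pi_{\mathcal{Q}}(F)=\lim_{n\to\infty}\mathrm{ex}_{\mathcal{Q}}(n,F)/(n2^{n-1})$. Then $\pi_{\mathcal{Q}}(C_6)\le 0.3755$, where $C_6$ is the cycle of length $6$.
   Context: $\mathcal{Q}_n$ has vertex set $\{0,1\}^n$, two vertices being adjacent iff they differ in exactly one coordinate; it has $n2^{n-1}$ edges. The ratio $\mathrm{ex}_{\mathcal{Q}}(n,F)/(n2^{n-1})$ is non-increasing in $n$, so the limit $\pi_{\mathcal{Q}}(F)$ exists. *)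

(* Defs.v *)
From HB Require Import structures.
From mathcomp Require Import all_classical all_reals all_analysis.
From mathcomp Require Import all_boot all_order all_algebra zify.
Import Order.TTheory GRing.Theory Num.Theory.
Import numFieldNormedType.Exports.

Set Implicit Arguments.
Unset Strict Implicit.
Unset Printing Implicit Defensive.

Record sgraph := SGraph {
  svertex :> finType;
  sadj : rel svertex;
  sadj_sym : symmetric sadj;
  sadj_irr : irreflexive sadj
}.

Definition sedges (G : sgraph) : {set {set G}} :=
  [set e | [exists x : G, exists y : G, sadj x y && (e == [set x; y])%SET]]%SET.

(* A pair H = (V, E) with V : {set G} and E : {set {set G}} stands for the
   graph with vertex set V and edge set E. *)
Definition is_subgraph (G : sgraph) (H : {set G} * {set {set G}}) : bool :=
  (H.2 \subset sedges G) && [forall e in H.2, e \subset H.1].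

Definition has_copy (F G : sgraph) (H : {set G} * {set {set G}}) : bool :=
  [exists f : {ffun F -> G},
    [&& injectiveb f, [forall x, f x \in H.1] &
        [forall x, forall y, sadj x y ==> ([set f x; f y]%SET \in H.2)]]].

(* Equals 0 when every subgraph of G contains F (F empty, say). *)
Definition ex_in (G F : sgraph) : nat :=
  \max_(H : {set G} * {set {set G}} | is_subgraph H && ~~ has_copy F H) #|H.2|.

Definition cube_adj (n : nat) : rel {ffun 'I_n -> bool} :=
  fun x y => #|[set i | x i != y i]%SET| == 1.

Lemma cube_adj_sym n : symmetric (@cube_adj n).
Proof.
by move=> x y; rewrite /cube_adj; congr (_ == _); apply: eq_card => i;
   rewrite !inE eq_sym.
Qed.

Lemma cube_adj_irr n : irreflexive (@cube_adj n).
Proof.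
by move=> x; rewrite /cube_adj eq_card0 // => i; rewrite !inE eqxx.
Qed.

Definition hypercube (n : nat) : sgraph :=
  SGraph (@cube_adj_sym n) (@cube_adj_irr n).

(* ordS i is i + 1 modulo k; the graph is the cycle of length k for k >= 3. *)
Definition cycle_adj (k : nat) : rel 'I_k :=
  fun i j => (i != j) && ((j == ordS i) || (i == ordS j)).

Lemma cycle_adj_sym k : symmetric (@cycle_adj k).
Proof. by move=> i j; rewrite /cycle_adj eq_sym orbC. Qed.

Lemma cycle_adj_irr k : irreflexive (@cycle_adj k).
Proof. by move=> i; rewrite /cycle_adj eqxx. Qed.

Definition cycle_graph (k : nat) : sgraph :=
  SGraph (@cycle_adj_sym k) (@cycle_adj_irr k).

Definition ex_Q (n : nat) (F : sgraph) : nat := ex_in (hypercube n) F.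

Definition ratio_Q (R : realType) (F : sgraph) (n : nat) : R :=
  ((ex_Q n F)%:R / (n * 2 ^ n.-1)%:R)%R.

Definition pi_Q (R : realType) (F : sgraph) : R :=
  limn (ratio_Q R F).

(* The rest shows that the limit defining pi_Q exists. *)
Definition face (n : nat) (p : 'I_n.+1 * bool) (x : {ffun 'I_n -> bool}) :
  {ffun 'I_n.+1 -> bool} := [ffun j => oapp x p.2 (unlift p.1 j)].

Lemma face_inj n (p : 'I_n.+1 * bool) : injective (face p).
Proof.
move=> x y /ffunP exy; apply/ffunP => i.
by have := exy (lift p.1 i); rewrite !ffunE liftK.
Qed.

Lemma face_adj n (p : 'I_n.+1 * bool) x y : cube_adj (face p x) (face p y) = cube_adj x y.
Proof.
rewrite /cube_adj -(card_imset _ (@lift_inj _ p.1)); congr (_ == _).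
apply: eq_card => j; rewrite inE !ffunE.
case: unliftP => [k ->|->] /=.
  by rewrite mem_imset ?inE //; exact: lift_inj.
rewrite eqxx; apply/esym/negbTE/imsetP => -[k _ /eqP].
by rewrite (negbTE (neq_lift _ _)).
Qed.

Lemma faceP n (p : 'I_n.+1 * bool) (u : {ffun 'I_n.+1 -> bool}) :
  u p.1 = p.2 -> u = face p [ffun k => u (lift p.1 k)].
Proof.
move=> up; apply/ffunP => j; rewrite ffunE.
by case: unliftP => [k ->|->] /=; rewrite ?ffunE.
Qed.

Definition face_sub (n : nat) (p : 'I_n.+1 * bool)
    (H : {set hypercube n.+1} * {set {set hypercube n.+1}}) :
  {set hypercube n} * {set {set hypercube n}} :=
  (face p @^-1: H.1, [set e : {set hypercube n} | face p @: e \in H.2])%SET.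

Lemma face_sub_subgraph n (p : 'I_n.+1 * bool) H : is_subgraph H -> is_subgraph (face_sub p H).
Proof.
move=> /andP[/subsetP sE /forall_inP sV]; apply/andP; split.
  apply/subsetP => e; rewrite inE => /sE; rewrite inE => /existsP[u /existsP[v]].
  move=> /andP[uv /eqP fe].
  have /imsetP[x xe ux] : u \in (face p @: e)%SET by rewrite fe !inE eqxx.
  have /imsetP[y ye vy] : v \in (face p @: e)%SET by rewrite fe !inE eqxx orbT.
  rewrite inE; apply/existsP; exists x; apply/existsP; exists y.
  apply/andP; split; first by move: uv; rewrite ux vy /= face_adj.
  apply/eqP; apply: (imset_inj (@face_inj _ p)).
  by rewrite fe imsetU1 imset_set1 ux vy.
apply/forall_inP => e; rewrite inE => /sV/subsetP eV.
by apply/subsetP => x xe; rewrite inE; apply: eV; apply: imset_f.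
Qed.

Lemma face_sub_copy F n (p : 'I_n.+1 * bool) H : has_copy F (face_sub p H) -> has_copy F H.
Proof.
move=> /existsP[f /and3P[/injectiveP fi /forallP fV /forallP fE]].
apply/existsP; exists [ffun x => face p (f x)]; apply/and3P; split.
- by apply/injectiveP => x y; rewrite !ffunE => /face_inj/fi.
- by apply/forallP => x; rewrite ffunE; have := fV x; rewrite inE.
- apply/forallP => x; apply/forallP => y; apply/implyP => xy.
  move: (fE x) => /forallP/(_ y)/implyP/(_ xy).
  by rewrite inE imsetU1 imset_set1 !ffunE.
Qed.

Lemma face_sub_count n (H : {set hypercube n.+1} * {set {set hypercube n.+1}}) :
  is_subgraph H ->
  n * #|H.2| <= \sum_(p : 'I_n.+1 * bool) #|(face_sub p H).2|.
Proof.
move=> /andP[/subsetP sE _].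
have cardE (p : 'I_n.+1 * bool) : #|(face_sub p H).2| =
    \sum_(e in H.2) (e \in [set face p @: (d : {set hypercube n}) | d in setT]%SET).
  rewrite -(card_imset _ (imset_inj (@face_inj _ p))) -sum1_card.
  rewrite [RHS]big_mkcond [LHS]big_mkcond; apply: eq_bigr => e _ /=.
  case: ifP => [/imsetP[d dH ->]|].
    by move: dH; rewrite inE => ->; rewrite imset_f ?inE.
  move=> eN; case: ifP => // eH; case: imsetP => // -[d _ ed].
  by case/negP: (negbT eN); apply/imsetP; exists d => //; rewrite inE -ed.
rewrite (eq_bigr _ (fun p _ => cardE p)) exchange_big /= mulnC -sum_nat_const.
apply: leq_sum => e /sE; rewrite inE => /existsP[u /existsP[v /andP[uv /eqP ->]]].
move: uv => /cards1P[k /setP uvk].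
have inj_h : injective (fun j : 'I_n => (lift k j, (u : {ffun _}) (lift k j))).
  by move=> i j /(congr1 fst)/lift_inj.
rewrite -big_mkcond sum1_card -{1}(card_ord n) -(card_imset _ inj_h).
apply/subset_leq_card/subsetP => p /imsetP[j _ ->].
rewrite unfold_in /=; set p0 := (lift k j, _).
have vu : (v : {ffun _}) (lift k j) = (u : {ffun _}) (lift k j).
  have := uvk (lift k j); rewrite !inE (eq_sym _ k) (negbTE (neq_lift _ _)).
  by move/negbFE/eqP.
apply/imsetP; exists ([set [ffun i => (u : {ffun _}) (lift (lift k j) i)];
  [ffun i => (v : {ffun _}) (lift (lift k j) i)]]%SET) => //.
by rewrite imsetU1 imset_set1 -!(@faceP _ p0).
Qed.

Lemma ex_Q_step n F : n * ex_Q n.+1 F <= (n.+1).*2 * ex_Q n F.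
Proof.
have [->//|n0] := posnP n.
rewrite mulnC -leq_divRL //; apply/bigmax_leqP => H /andP[sH nH].
rewrite leq_divRL // mulnC; apply: leq_trans (face_sub_count sH) _.
have -> : (n.+1).*2 = #|{: 'I_n.+1 * bool}|.
  by rewrite card_prod card_ord card_bool muln2.
rewrite -sum_nat_const; apply: leq_sum => p _.
rewrite /ex_Q /ex_in; apply: (leq_bigmax_cond (face_sub p H)).
rewrite face_sub_subgraph //=; apply: contra nH; exact: face_sub_copy.
Qed.

Lemma ratio_Q_nonincreasing (R : realType) (F : sgraph) (n : nat) :
  0 < n -> (ratio_Q R F n.+1 <= ratio_Q R F n)%R.
Proof.
move=> n0; rewrite /ratio_Q ler_pdivrMr ?ltr0n ?muln_gt0 ?expn_gt0 //.
rewrite mulrAC ler_pdivlMr ?ltr0n ?muln_gt0 ?n0 ?expn_gt0 //.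
rewrite -!natrM ler_nat -[n.+1.-1]/n.
have e2 : 2 ^ n = 2 * 2 ^ n.-1 by rewrite -expnS prednK.
rewrite e2 mulnA [X in X <= _]mulnAC.
have := leq_mul (ex_Q_step n F) (leqnn (2 ^ n.-1)).
rewrite -muln2; lia.
Qed.

Lemma ratio_Q_cvg (R : realType) (F : sgraph) : cvgn (ratio_Q R F).
Proof.
have : cvgn (fun n => ratio_Q R F n.+1).
  apply: nonincreasing_is_cvgn.
    by apply/nonincreasing_seqP => n; apply: ratio_Q_nonincreasing.
  by exists 0%R => _ [n _ <-]; rewrite /ratio_Q divr_ge0.
move=> /cvg_ex[l]; rewrite (cvg_shiftS (ratio_Q R F)) => cl.
by apply/cvg_ex; exists l.
Qed.

(* Main.v *)
(* Fix a C_6-free subgraph H of the cube and a base edge slot (x, k), that is, a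
   vertex x and a direction k, used by H or not. For every integer function g on
   the possible states of a face through (x, k), the square of the sum of g over
   the n - 1 such faces is nonnegative. Off-diagonal products of that square live
   on three-dimensional subcubes, the diagonal is of lower order, so summing over
   (x, k) gives, up to a 1/n error, a linear inequality on the densities of the
   2^12 edge patterns of a 3-cube. Two faces through (x, k) in which the other
   three edges are all present would form a C_6, so patterns with three edges on
   a face also have density O(1/n), and patterns containing a hexagon do not
   occur. For the eight functions g of [certificate], the sum of these
   inequalities bounds the edge density by 0.3755 pattern by pattern, after
   averaging over the symmetries of the 3-cube; this is a finite computation. The
   functions come from rounding the Cholesky factors of a solution of the
   corresponding semidefinite program, whose optimum is about 0.375498. *)
From Stdlib Require Import BinInt.
From HB Require Import structures.
Require Import Defs.
From mathcomp Require Import all_classical all_reals all_analysis.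
From mathcomp Require Import all_boot all_order all_algebra.
From mathcomp Require Import ssrZ ring lra zify.
Import Order.TTheory GRing.Theory Num.Theory.
Import numFieldNormedType.Exports.
Local Open Scope ring_scope.

Set Implicit Arguments.
Unset Strict Implicit.
Unset Printing Implicit Defensive.

(* The usual key %Z delimits [int_scope] here. *)
Delimit Scope Z_scope with coqZ.

(** * Edge patterns of the 3-cube *)

(* The 12 edges of a 3-cube at vertex x with directions p, q, r: the four
   p-edges at x, x+q, x+r, x+q+r, then the q-edges at x, x+p, x+r, x+p+r, then
   the r-edges at x, x+p, x+q, x+p+q; see [subcube]. *)
Definition config := seq bool.

(** This map and the next three turn the pattern of [subcube x p q r] into that of the same 3-cube
    with its directions permuted, or seen from x + q or x + r. *)
Definition swap_qr (h : config) : config :=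
  if h is [:: a0; a1; a2; a3; b0; b1; b2; b3; c0; c1; c2; c3]
  then [:: a0; a2; a1; a3; c0; c1; c2; c3; b0; b1; b2; b3] else h.

Definition rot_pqr (h : config) : config :=
  if h is [:: a0; a1; a2; a3; b0; b1; b2; b3; c0; c1; c2; c3]
  then [:: b0; b2; b1; b3; c0; c2; c1; c3; a0; a1; a2; a3] else h.

Definition flip_q (h : config) : config :=
  if h is [:: a0; a1; a2; a3; b0; b1; b2; b3; c0; c1; c2; c3]
  then [:: a1; a0; a3; a2; b0; b1; b2; b3; c2; c3; c0; c1] else h.

Definition flip_r (h : config) : config :=
  if h is [:: a0; a1; a2; a3; b0; b1; b2; b3; c0; c1; c2; c3]
  then [:: a2; a3; a0; a1; b2; b3; b0; b1; c0; c1; c2; c3] else h.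

Definition base_edge (h : config) : bool := nth false h 0.

(* Numbers the states of a face with base edge t: a and b are the edges leaving
   its two ends, c the edge opposite to it. *)
Definition flag_index (t a b c : bool) : nat := (a + b.*2 + c.*2.*2 + t.*2.*2.*2)%N.

Definition flag_q (h : config) : nat :=
  flag_index (nth false h 0) (nth false h 4) (nth false h 5) (nth false h 1).
Definition flag_r (h : config) : nat :=
  flag_index (nth false h 0) (nth false h 8) (nth false h 9) (nth false h 2).

Definition has_P4 (h : config) : bool :=
  [&& nth false h 4, nth false h 5 & nth false h 1].

(** The hexagon missing the antipodal vertices x + q and x + p + r. The flips in [symmetrized] carry
    it to the other three hexagons of this kind. *)
Definition has_hexagon (h : config) : bool :=
  [&& nth false h 0, nth false h 5, nth false h 11,
      nth false h 3, nth false h 6 & nth false h 8].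

(* Rows are indexed by [flag_index] and padded with zeros. Every row is even or
   odd under exchange of the ends of the base edge, which is why [symmetrized]
   need not average over the flip of p. *)
Definition certificate : seq (seq Z) := [::
  [:: 24266; -5189; -5189; -37903; 36105; -13866; -13866];
  [:: 0; 4765; 4765; 6293; 19747; -9707; -9707];
  [:: 0; 0; 0; 7322];
  [:: 0; 24459; -24459; 0; 0; -1785; 1785];
  [:: 0; 0; 0; 0; 0; 37463; -37463];
  [:: 0; 0; 0; 0; 0; 0; 0; 0; 27839; -9230; -9230; 0; 25050];
  [:: 0; 0; 0; 0; 0; 0; 0; 0; 0; 0; 0; 0; 5781];
  [:: 0; 0; 0; 0; 0; 0; 0; 0; 0; 25387; -25387]]%coqZ.

(** A common integer scale, 39600 squared; [bound_weight] is exactly 0.3755 times it. *)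
Definition edge_weight : Z := 1568160000%coqZ.
Definition bound_weight : Z := 588844080%coqZ.
(* Any large value will do: it makes the patterns of negligible density satisfy
   the pointwise inequality. *)
Definition penalty : Z := 100000000000%coqZ.

(** Its total over all 3-cubes is at most 0 by finite computation, while the products and penalties
    contribute at least a negative term of lower order. What is left compares the edge density with
    0.3755. *)
Definition objective (h : config) : Z :=
  (edge_weight *+ base_edge h - bound_weight
  + \sum_(g <- certificate) g`_(flag_q h) * g`_(flag_r h)
  - penalty *+ has_P4 h - penalty *+ has_hexagon h)%R.

Definition add_image (g : config -> config) (F : config -> Z) (h : config) : Z :=
  (F h + F (g h))%R.

(** A sum over 2 * 3 * 4 = 24 symmetries rather than an average, so that values stay integers. *)
Definition symmetrized (F : config -> Z) : config -> Z :=
  add_image swap_qr (fun h =>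
    add_image flip_q (add_image flip_r F) h
    + add_image flip_q (add_image flip_r F) (rot_pqr h)
    + add_image flip_q (add_image flip_r F) (rot_pqr (rot_pqr h))).

Fixpoint configs (m : nat) : seq config :=
  if m is m'.+1 then
    [seq true :: h | h <- configs m'] ++ [seq false :: h | h <- configs m']
  else [:: [::]].

Lemma mem_configs (h : config) : h \in configs (size h).
Proof.
elim: h => // b h IH /=; rewrite mem_cat; apply/orP.
by case: b; [left|right]; apply: map_f.
Qed.

Lemma symmetrized_objective_le0 (h : config) : size h = 12 -> symmetrized objective h <= 0.
Proof.
move=> hs; have := mem_configs h; rewrite hs; move: h {hs}.
(* [unlock] opens the sum over [certificate], so that all 4096 patterns can be evaluated. *)
apply/allP; rewrite /symmetrized /add_image /objective unlock.
vm_cast_no_check (erefl true).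
Qed.

Lemma weight_ratio : 10%:R ^+ 4 * bound_weight = 3755%:R * edge_weight.
Proof. by vm_compute. Qed.

(** * Sums over subcubes *)

Definition flip n (x : {ffun 'I_n -> bool}) (d : 'I_n) : {ffun 'I_n -> bool} :=
  [ffun i => x i (+) (i == d)].

Lemma flipK n (x : {ffun 'I_n -> bool}) (d : 'I_n) : flip (flip x d) d = x.
Proof. by apply/ffunP => i; rewrite !ffunE addbK. Qed.

Lemma flip_inj n (d : 'I_n) : injective (fun x => flip x d).
Proof. by move=> x y /(congr1 (fun z => flip z d)); rewrite !flipK. Qed.

Lemma flipC n (x : {ffun 'I_n -> bool}) (c d : 'I_n) :
  flip (flip x c) d = flip (flip x d) c.
Proof. by apply/ffunP => i; rewrite !ffunE addbAC. Qed.

Definition square_bound : Z := 1500000000%coqZ.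
(** The diagonal of each square costs at most [square_bound], and the patterns with [has_P4] cost
    [penalty], both per unit of 2^n n^2. *)
Definition error_weight  : Z := (square_bound *+ size certificate + penalty)%R.

Lemma certificate_square_le g (h : config) : g \in certificate -> g`_(flag_q h) ^+ 2 <= square_bound.
Proof.
rewrite /flag_q; case: (nth _ _ 0) (nth _ _ 4) (nth _ _ 5) (nth _ _ 1) => [] [] [] [];
  by apply/allP: g; vm_compute.
Qed.

Section SubcubeSums.

Variables (n : nat) (e : {ffun 'I_n -> bool} -> 'I_n -> bool).
Hypothesis e_flip : forall x d, e (flip x d) d = e x d.

Implicit Types (x : {ffun 'I_n -> bool}) (p q r : 'I_n).

Definition subcube x p q r : config :=
  [:: e x p; e (flip x q) p; e (flip x r) p; e (flip (flip x q) r) p;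
      e x q; e (flip x p) q; e (flip x r) q; e (flip (flip x p) r) q;
      e x r; e (flip x p) r; e (flip x q) r; e (flip (flip x p) q) r].

(** Each 3-subcube is counted 48 times, once per vertex and order of its directions; hence the
    invariance under symmetries. *)
Definition total (F : config -> Z) : Z :=
  \sum_p \sum_q \sum_(r | uniq [:: p; q; r]) \sum_x F (subcube x p q r).

Lemma totalD F G : total (fun h => F h + G h) = total F + total G.
Proof.
rewrite /total -big_split; apply: eq_bigr => p _ /=.
rewrite -big_split; apply: eq_bigr => q _ /=.
rewrite -big_split; apply: eq_bigr => r _ /=.
by rewrite -big_split.
Qed.

Lemma eq_total F G : F =1 G -> total F = total G.
Proof.
move=> FG; rewrite /total; apply: eq_bigr => p _; apply: eq_bigr => q _.
by apply: eq_bigr => r _; apply: eq_bigr => x _; rewrite FG.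
Qed.

Lemma totalZ c F : total (fun h => c * F h) = c * total F.
Proof.
rewrite /total mulr_sumr; apply: eq_bigr => p _.
rewrite mulr_sumr; apply: eq_bigr => q _.
rewrite mulr_sumr; apply: eq_bigr => r _.
by rewrite mulr_sumr.
Qed.

Lemma total_sum (I : Type) (s : seq I) (F : I -> config -> Z) :
  total (fun h => \sum_(i <- s) F i h) = \sum_(i <- s) total (F i).
Proof.
elim: s => [|i s IH].
  rewrite big_nil /total big1 // => p _; rewrite big1 // => q _.
  by rewrite big1 // => r _; rewrite big1 // => x _; rewrite big_nil.
by rewrite big_cons -IH -totalD; apply: eq_total => h; rewrite big_cons.
Qed.

Lemma total_swap F : total (F \o swap_qr) = total F.
Proof.
rewrite /total; apply: eq_bigr => p _.
under eq_bigr do rewrite big_mkcond; rewrite exchange_big; apply: eq_bigr => r _ /=.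
rewrite [RHS]big_mkcond; apply: eq_bigr => q _.
rewrite !inE [r == q]eq_sym !negb_or !andbT [(p != r) && _]andbC.
case: ifP => // _; apply: eq_bigr => x _.
by rewrite /subcube [flip (flip x q) r]flipC.
Qed.

Lemma total_rot F : total (F \o rot_pqr) = total F.
Proof.
have rot_sum (G : 'I_n -> 'I_n -> 'I_n -> Z) :
    \sum_p \sum_q \sum_r G q r p = \sum_p \sum_q \sum_r G p q r.
  by rewrite exchange_big; apply: eq_bigr => q _; rewrite exchange_big.
rewrite /total.
under [RHS]eq_bigr do under eq_bigr do rewrite big_mkcond.
rewrite -rot_sum; apply: eq_bigr => p _; apply: eq_bigr => q _.
rewrite big_mkcond; apply: eq_bigr => r _ /=.
rewrite !inE !negb_or !andbT [q == p]eq_sym [r == p]eq_sym.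
rewrite [RHS](_ : _ = if (p != q) && (p != r) && (q != r) then
  \sum_x F (subcube x q r p) else 0); last by case: (p != q) (p != r) (q != r) => [] [] [].
case: ifP => // _; apply: eq_bigr => x _.
by rewrite /subcube [flip (flip x r) p]flipC [flip (flip x q) p]flipC.
Qed.

Lemma e_flip2 x c d : e (flip (flip x d) c) d = e (flip x c) d.
Proof. by rewrite flipC e_flip. Qed.

Lemma e_flip3 x b c d : e (flip (flip (flip x d) c) b) d = e (flip (flip x c) b) d.
Proof. by rewrite (flipC x) e_flip2. Qed.

Lemma total_flip_q F : total (F \o flip_q) = total F.
Proof.
rewrite /total; apply: eq_bigr => p _; apply: eq_bigr => q _.
apply: eq_bigr => r _.
(* Moves the base vertex along q; [e_flip] then identifies the slots at the two ends of each
   edge. *)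
rewrite [RHS](reindex_inj (@flip_inj n q)).
apply: eq_bigr => x _ /=.
by rewrite /subcube !e_flip3 !e_flip2 !e_flip !flipK (flipC x q p) !flipK.
Qed.

Lemma total_flip_r F : total (F \o flip_r) = total F.
Proof.
rewrite /total; apply: eq_bigr => p _; apply: eq_bigr => q _.
apply: eq_bigr => r _.
rewrite [RHS](reindex_inj (@flip_inj n r)).
apply: eq_bigr => x _ /=.
by rewrite /subcube !e_flip3 !e_flip2 !e_flip !(flipC x r) !flipK.
Qed.

Lemma total_symmetrized F : total (symmetrized F) = total F *+ 24.
Proof.
have add g G : total (G \o g) = total G -> total (add_image g G) = total G *+ 2.
  by rewrite /add_image totalD => ->; rewrite mulr2n.
have rot G : total (fun h => G (rot_pqr h)) = total G by exact: total_rot.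
rewrite /symmetrized add; last exact: total_swap.
have rot3 G : total (fun h => G h + G (rot_pqr h) + G (rot_pqr (rot_pqr h))) = total G *+ 3.
  by rewrite 2!totalD (rot G) [X in _ + X](rot (G \o rot_pqr)) (rot G) !mulrS mulr0n addr0 addrA.
rewrite rot3.
rewrite add; last exact: total_flip_q.
rewrite add; last exact: total_flip_r.
by rewrite -!mulrnA.
Qed.

(** [objective] itself is positive on some patterns, such as the base edge alone; only its
    symmetrization is bounded pointwise. *)
Lemma total_objective_le0 : total objective <= 0.
Proof.
have : total (symmetrized objective) <= 0.
  apply: sumr_le0 => p _; apply: sumr_le0 => q _; apply: sumr_le0 => r _.
  by apply: sumr_le0 => x _; apply: symmetrized_objective_le0.
by rewrite total_symmetrized pmulrn_lle0.
Qed.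

Lemma total_nested F : total F =
  \sum_x \sum_p \sum_(q | q != p) \sum_(r | (r != p) && (r != q)) F (subcube x p q r).
Proof.
rewrite [RHS]exchange_big; apply: eq_bigr => p _ /=.
rewrite [RHS]exchange_big [RHS]big_mkcond; apply: eq_bigr => q _ /=.
case: eqP => [->|/eqP qp] /=; first by rewrite big1 // => r; rewrite inE eqxx.
rewrite [RHS]exchange_big; apply: eq_bigl => r.
by rewrite !inE !negb_or !andbT (eq_sym p q) qp (eq_sym p r) (eq_sym q r).
Qed.

Lemma total_base (f : {ffun 'I_n -> bool} -> 'I_n -> Z) F :
    (forall x p q r, F (subcube x p q r) = f x p) ->
  total F = (\sum_x \sum_p f x p) * (n.-1 * n.-2)%:R.
Proof.
move=> Ff; rewrite total_nested mulr_suml; apply: eq_bigr => x _.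
rewrite mulr_suml; apply: eq_bigr => p _.
rewrite natrM mulrA [_ * n.-1%:R]mulr_natr.
transitivity (\sum_(q | q != p) f x p * n.-2%:R).
  apply: eq_bigr => q qp; under eq_bigr do rewrite Ff.
  rewrite sumr_const mulr_natr; congr (_ *+ _).
  have := cardC (pred2 p q); rewrite card2 eq_sym qp card_ord => cn.
  have -> : n.-2 = #|[predC (pred2 p q)]| by rewrite -{1}cn.
  by apply: eq_card => r; rewrite !inE negb_or.
rewrite sumr_const mulrnAl; congr (_ *+ _).
by have := cardC1 p; rewrite card_ord.
Qed.

(** For fixed x and p the two factors depend on q alone and on r alone, so the sum over q != r is a
    full square minus its diagonal of at most n terms. *)
Lemma total_square_ge (g : nat -> Z) (c : Z) :
    (forall h : config, g (flag_q h) ^+ 2 <= c) ->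
  - (c *+ (2 ^ n * n * n)) <= total (fun h => g (flag_q h) * g (flag_r h)).
Proof.
move=> gc; rewrite total_nested.
have -> : c *+ (2 ^ n * n * n) = \sum_(x : {ffun 'I_n -> bool}) \sum_(p < n) c *+ n.
  by rewrite !sumr_const card_ffun !card_ord card_bool -!mulrnA; congr (_ *+ _); rewrite mulnC mulnA mulnC mulnA.
rewrite -sumrN; apply: ler_sum => x _; rewrite -sumrN; apply: ler_sum => p _.
(* The degenerate choice r = q is harmless: [flag_q] reads no edge that depends on r. *)
pose u q := g (flag_q (subcube x p q q)).
have uP q r : g (flag_q (subcube x p q r)) = u q by [].
have uP' q r : g (flag_r (subcube x p q r)) = u r by [].
have c0 : 0 <= c by apply: le_trans (gc [::]); rewrite sqr_ge0.
have -> : \sum_(q | q != p) \sum_(r | (r != p) && (r != q))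
    g (flag_q (subcube x p q r)) * g (flag_r (subcube x p q r))
  = (\sum_(q | q != p) u q) ^+ 2 - \sum_(q | q != p) u q ^+ 2.
  rewrite expr2 mulr_suml -sumrB; apply: eq_bigr => q qp.
  rewrite [in RHS](bigD1 q) //= mulrDr expr2 addrAC subrr add0r mulr_sumr.
  by apply: eq_bigr => r _; rewrite uP uP'.
apply: le_trans (lerB (sqr_ge0 _) (lexx _)); rewrite sub0r lerN2.
apply: le_trans (_ : \sum_(q | q != p) c <= _).
  by apply: ler_sum => q _; apply: gc.
by rewrite sumr_const ler_wpMn2l // -[leqRHS]card_ord max_card.
Qed.

(** For each slot (x, p) at most one q gives such a path, and r then has at most n choices. *)
Lemma total_P4_le :
    (forall x p q r, q != p -> r != p -> r != q ->
      [&& e x q, e (flip x p) q & e (flip x q) p] ->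
      ~~ [&& e x r, e (flip x p) r & e (flip x r) p]) ->
  total (fun h => (has_P4 h)%:R) <= (2 ^ n * n * n)%:R.
Proof.
move=> theta_free; rewrite total_nested.
have -> : (2 ^ n * n * n)%:R = \sum_(x : {ffun 'I_n -> bool}) \sum_(p < n) n%:R :> Z.
  by rewrite !sumr_const card_ffun !card_ord card_bool -!mulrnA; congr (_ *+ _); rewrite mulnC mulnA mulnC mulnA.
apply: ler_sum => x _; apply: ler_sum => p _.
pose b q := [&& e x q, e (flip x p) q & e (flip x q) p].
apply: le_trans (_ : \sum_(q | q != p) (b q)%:R * n%:R <= _).
  apply: ler_sum => q _; rewrite /has_P4 /= -/(b q) sumr_const mulr_natr.
  by rewrite ler_wpMn2l // -[leqRHS]card_ord max_card.
rewrite -mulr_suml -{2}[n%:R]mul1r ler_wpM2r ?ler0n //.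
have [q /andP[qp bq]|nb] := pickP (fun q => (q != p) && b q).
  rewrite (bigD1 q) //= bq big1 ?addr0 // => r /andP[rp rq].
  by have /negbTE := theta_free _ _ _ _ qp rp rq bq; rewrite -/(b r) => ->.
by rewrite big1 ?ler01 // => q qp; have := nb q; rewrite qp /= => ->.
Qed.

Lemma total_hexagon0 :
    (forall x p q r, uniq [:: p; q; r] -> ~~ has_hexagon (subcube x p q r)) ->
  total (fun h => (has_hexagon h)%:R) = 0.
Proof.
move=> hexagon_free; rewrite /total big1 // => p _; rewrite big1 // => q _.
by rewrite big1 // => r pqr; rewrite big1 // => x _; rewrite (negbTE (hexagon_free _ _ _ _ pqr)).
Qed.

Lemma edge_count_bound :
    (forall x p q r, q != p -> r != p -> r != q ->
      [&& e x q, e (flip x p) q & e (flip x q) p] ->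
      ~~ [&& e x r, e (flip x p) r & e (flip x r) p]) ->
    (forall x p q r, uniq [:: p; q; r] -> ~~ has_hexagon (subcube x p q r)) ->
  edge_weight * ((\sum_x \sum_p (e x p)%:R) * (n.-1 * n.-2)%:R)
    <= bound_weight * (2 ^ n * n * (n.-1 * n.-2))%:R + error_weight * (2 ^ n * n * n)%:R.
Proof.
move=> theta_free hexagon_free.
have := total_objective_le0.
(* Writes [objective] as a linear combination, so that [total] can be distributed over it. *)
rewrite (eq_total (G := fun h => edge_weight * (base_edge h)%:R + (- bound_weight) * 1
    + (\sum_(g <- certificate) g`_(flag_q h) * g`_(flag_r h))
    + (- penalty) * (has_P4 h)%:R + (- penalty) * (has_hexagon h)%:R)); last first.
  by move=> h; rewrite /objective mulr1 !mulNr !mulr_natr.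
rewrite !totalD !totalZ total_hexagon0 // mulr0 addr0 total_sum.
rewrite (total_base (f := fun x p => (e x p)%:R)) //.
rewrite (total_base (f := fun x p => 1)) //.
have -> : (\sum_(x : {ffun 'I_n -> bool}) \sum_(p < n) 1) * (n.-1 * n.-2)%:R
    = (2 ^ n * n * (n.-1 * n.-2))%:R :> Z.
  by rewrite !sumr_const card_ffun !card_ord card_bool -mulrnA [RHS]natrM mulnC.
have P4_le := total_P4_le theta_free.
have squares_ge : - (square_bound *+ size certificate * (2 ^ n * n * n)%:R)
    <= \sum_(g <- certificate) total (fun h => g`_(flag_q h) * g`_(flag_r h)).
  have -> : - (square_bound *+ size certificate * (2 ^ n * n * n)%:R)
      = \sum_(g <- certificate) - (square_bound *+ (2 ^ n * n * n)).
    by rewrite big_const_seq count_predT iter_addr addr0 mulr_natr mulNrn mulrnAC.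
  rewrite !big_seq; apply: ler_sum => g gc; apply: (total_square_ge (g := nth 0 g)) => h.
  exact: certificate_square_le.
move: squares_ge P4_le; set U := (2 ^ n * n * n)%:R.
set S := \sum_(g <- certificate) _; set T := total _.
set X := edge_weight * _; set Y := bound_weight * _ => S_ge T_le.
rewrite !mulNr -/Y => le0; rewrite /error_weight mulrDl.
have : penalty * T <= penalty * U by rewrite ler_wpM2l.
move: le0 S_ge; set Q := _ * U; set W := penalty * U; set W' := penalty * T; lra.
Qed.

End SubcubeSums.

(** * Six-cycle-free subgraphs of the cube *)

Section CycleFree.

Variables (n : nat) (H : {set hypercube n} * {set {set hypercube n}}).
Hypothesis H_sub : is_subgraph H.

Definition has_edge (x : {ffun 'I_n -> bool}) (d : 'I_n) : bool :=
  ([set x; flip x d]%SET : {set hypercube n}) \in H.2.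

Lemma has_edge_flip x d : has_edge (flip x d) d = has_edge x d.
Proof. by rewrite /has_edge flipK setUC. Qed.

Lemma has_edgeC x d : (([set flip x d; x]%SET : {set hypercube n}) \in H.2) = has_edge x d.
Proof. by rewrite /has_edge setUC. Qed.

Lemma edge_mem (u v : hypercube n) : [set u; v]%SET \in H.2 -> u \in H.1.
Proof.
case/andP: H_sub => _ /forall_inP sV /sV/subsetP; apply.
by rewrite !inE eqxx.
Qed.

Lemma has_copy_cycle (s : seq (hypercube n)) :
    uniq s -> cycle (fun u v => [set u; v]%SET \in H.2) s ->
  has_copy (cycle_graph (size s)) H.
Proof.
case: s => [|x p] us cs.
  (* The empty cycle has no vertices, so any map will do. *)
  apply/existsP; exists [ffun i => [ffun=> false]]; apply/and3P.
  by split; [apply/injectiveP; case | apply/forallP; case | apply/forallP; case].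
set s := x :: p in us *.
have es (i : 'I_(size s)) : [set nth x s i; nth x s (ordS i)]%SET \in H.2.
  have /pathP/(_ i) := cs; rewrite size_rcons => /(_ x (ltn_ord i)).
  rewrite -[x :: rcons _ _]/(rcons s x) nth_rcons ltn_ord nth_rcons.
  (* The last index is separate: there [ordS] wraps around to 0, giving the closing edge. *)
  rewrite /= -/s; case: ltngtP (ltn_ord i : i <= size p)%N => // [ip|->] _.
    by rewrite modn_small.
  by rewrite modnn.
apply/existsP; exists [ffun i : 'I_(size s) => nth x s i]; apply/and3P; split.
- by apply/injectiveP => i j; rewrite !ffunE => /eqP; rewrite nth_uniq // => /eqP/val_inj.
- by apply/forallP => i; rewrite ffunE; apply: edge_mem (es i).
- apply/forallP => i; apply/forallP => j; apply/implyP => /andP[_].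
  by rewrite !ffunE => /orP[/eqP->|/eqP->]; rewrite // setUC.
Qed.

(** Double counting: an edge with ends u, v in direction d occupies the two slots (u, d) and (v,
    d). *)
Lemma card_edges_le : (#|H.2| * 2)%N%:R <= \sum_x \sum_d (has_edge x d)%:R :> Z.
Proof.
rewrite pair_bigA /= -natr_sum ler_nat.
pose ends (y : {ffun 'I_n -> bool} * 'I_n) : {set hypercube n} := [set y.1; flip y.1 y.2]%SET.
have -> : (\sum_(y : {ffun 'I_n -> bool} * 'I_n) has_edge y.1 y.2 =
    \sum_(E in H.2) \sum_(y | ends y == E) 1)%N.
  rewrite (exchange_big_dep predT) //=; apply: eq_bigr => y _.
  rewrite /has_edge -/(ends y); case: (boolP (ends y \in H.2)) => yH.
    by rewrite (big_pred1 (ends y)) // => E /=; rewrite (eq_sym E); case: eqP => [<-|]; rewrite ?yH ?andbF.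
  by rewrite big1 // => E /andP[EH /eqP yE]; move: yH; rewrite yE EH.
rewrite -sum_nat_const; apply: leq_sum => E EH.
case/andP: H_sub => /subsetP/(_ _ EH); rewrite inE => /existsP[u /existsP[v]].
move=> /andP[/cards1P[d /setP uvd] /eqP Euv] _.
have vu : v = flip (u : {ffun _}) d.
  apply/ffunP => i; rewrite ffunE; have := uvd i; rewrite !inE => <-.
  have xor_neq (a b : bool) : b = a (+) (a != b) by case: a b => [] [].
  exact: xor_neq.
have uv : u != v.
  by apply/eqP => uv; have := uvd d; rewrite !inE uv !eqxx.
rewrite sum1_card (@leq_trans #|pred2 ((u, d) : {ffun 'I_n -> bool} * 'I_n) (v, d)|) //.
  by rewrite card2 xpair_eqE (negbTE uv).
apply/subset_leq_card/subsetP => y; rewrite !inE => /orP[/eqP->|/eqP->].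
  by change (ends (u, d) == E); rewrite /ends /= -vu Euv.
by change (ends (v, d) == E); rewrite /ends /= {2}vu flipK setUC Euv.
Qed.

Hypothesis H_free : ~~ has_copy (cycle_graph 6) H.

(* The two faces at (x, p) in directions q and r, without the base edge. *)
Lemma theta_free x p q r : q != p -> r != p -> r != q ->
  [&& has_edge x q, has_edge (flip x p) q & has_edge (flip x q) p] ->
  ~~ [&& has_edge x r, has_edge (flip x p) r & has_edge (flip x r) p].
Proof.
move=> qp rp rq /and3P[xq xpq xqp]; apply: contra H_free => /and3P[xr xpr xrp].
apply: (@has_copy_cycle [:: x; flip x q; flip (flip x q) p;
  flip x p; flip (flip x p) r; flip x r]).
  (* The six vertices are told apart by which of the coordinates p, q, r differ from those of x. *)
  pose coord (y : {ffun 'I_n -> bool}) := (x p (+) y p, x q (+) y q, x r (+) y r).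
  apply: (@map_uniq _ _ coord).
  by rewrite /= /coord !ffunE !addbA !addbb !eqxx ![p == _]eq_sym ![q == r]eq_sym
    (negbTE qp) (negbTE rp) (negbTE rq).
rewrite /= -!/(has_edge _ _).
rewrite xq xqp xpr (flipC x q p) has_edgeC xpq (flipC x p r).
by rewrite !has_edgeC xrp xr.
Qed.

Lemma hexagon_free x p q r :
  uniq [:: p; q; r] -> ~~ has_hexagon (subcube has_edge x p q r).
Proof.
rewrite /= !inE negb_or andbT => /andP[/andP[pq pr] qr].
apply: contra H_free => /and5P[/= e0 e1 e2 e3 /andP[e4 e5]].
apply: (@has_copy_cycle [:: x; flip x p; flip (flip x p) q;
  flip (flip (flip x p) q) r; flip (flip x q) r; flip x r]).
  pose coord (y : {ffun 'I_n -> bool}) := (x p (+) y p, x q (+) y q, x r (+) y r).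
  apply: (@map_uniq _ _ coord).
  by rewrite /= /coord !ffunE !addbA !addbb !eqxx ![r == _]eq_sym ![q == p]eq_sym
    (negbTE pq) (negbTE pr) (negbTE qr).
rewrite /= -!/(has_edge _ _) e0 e1 e2 (flipC x p q) (flipC (flip x q) p r).
by rewrite has_edgeC e3 (flipC x q r) !has_edgeC e4 e5.
Qed.

Lemma edges_free_bound :
  edge_weight * ((#|H.2| * 2)%:R * (n.-1 * n.-2)%:R)
    <= bound_weight * (2 ^ n * n * (n.-1 * n.-2))%:R + error_weight * (2 ^ n * n * n)%:R.
Proof.
apply: le_trans (edge_count_bound has_edge_flip theta_free hexagon_free).
by rewrite ler_wpM2l // ler_wpM2r ?ler0n // card_edges_le.
Qed.

End CycleFree.

(** * Extremal numbers and passage to the limit *)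

Lemma ex_Q_bound n :
  edge_weight * ((ex_Q n (cycle_graph 6) * 2)%:R * (n.-1 * n.-2)%:R)
    <= bound_weight * (2 ^ n * n * (n.-1 * n.-2))%:R + error_weight * (2 ^ n * n * n)%:R.
Proof.
rewrite /ex_Q /ex_in; elim/big_ind: _ => [|a b ha hb|H /andP[sH nH]].
- by rewrite mul0n mul0r mulr0 addr_ge0 // mulr_ge0 // ler0n.
- by rewrite /maxn; case: ifP.
- exact: edges_free_bound.
Qed.

(** Carries the inequality from the binary integers used for computation to the reals. *)
Definition Z_to (R : pzRingType) (z : Z) : R := (int_of_Z z)%:~R.
Arguments Z_to R z : clear implicits.

HB.instance Definition _ (R : pzRingType) :=
  GRing.RMorphism.copy (Z_to R) (intmul (1 : R) \o int_of_Z).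

Lemma Z_to_ge0 (R : numDomainType) (z : Z) : 0 <= z -> 0 <= Z_to R z.
Proof. by case: z => // p _; rewrite ler0z. Qed.

Lemma ler_Z_to (R : numDomainType) (y z : Z) : y <= z -> Z_to R y <= Z_to R z.
Proof. by move=> yz; rewrite -subr_ge0 -rmorphB Z_to_ge0 // subr_ge0. Qed.

Lemma Z_to_gt0 (R : numDomainType) (z : Z) : 0 < z -> 0 < Z_to R z.
Proof.
rewrite !lt0r => /andP[z0 /Z_to_ge0-> /=]; rewrite andbT /Z_to intr_eq0.
by rewrite -(rmorph0 int_of_Z) (can_eq int_of_ZK).
Qed.

Lemma ratio_Q_le_inv (R : realType) (F : sgraph) (a b : nat) (A B C : Z) :
    0 < A -> 0 <= C -> b%:R * B = a%:R * A -> (0 < b)%N ->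
    (forall n, A * ((ex_Q n F * 2)%:R * (n.-1 * n.-2)%:R)
      <= B * (2 ^ n * n * (n.-1 * n.-2))%:R + C * (2 ^ n * n * n)%:R) ->
  forall n, (3 < n)%N ->
  ratio_Q R F n <= a%:R / b%:R + 4%:R * Z_to R C / Z_to R A * n%:R^-1.
Proof.
move=> A0 C0 AB b0 ineq n n3.
have {}A0 : 0 < Z_to R A by apply: Z_to_gt0.
have {}C0 : 0 <= Z_to R C by apply: Z_to_ge0.
have {}AB := congr1 (Z_to R) AB.
rewrite 2!rmorphM 2!rmorph_nat /= in AB.
have {ineq} := ler_Z_to R (ineq n).
rewrite rmorphD 4!rmorphM 4!rmorph_nat /=.
move: (Z_to R A) (Z_to R B) (Z_to R C) A0 C0 AB => {}A {}B {}C A0 C0 AB.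
have -> : (2 ^ n * n * (n.-1 * n.-2) = 2 * (n * 2 ^ n.-1) * (n.-1 * n.-2))%N.
  by rewrite -{1}[n](ltn_predK n3) expnS; ring.
have -> : (2 ^ n * n * n = 2 * (n * 2 ^ n.-1) * n)%N.
  by rewrite -{1}[n](ltn_predK n3) expnS; ring.
rewrite /ratio_Q.
have D0 : 0 < (n * 2 ^ n.-1)%:R :> R.
  by rewrite ltr0n muln_gt0 expn_gt0 (ltn_trans _ n3).
have N0 : 0 < (n.-1 * n.-2)%:R :> R.
  by rewrite ltr0n muln_gt0; case: n n3 {D0} => [|[|[|n]]].
have n0 : 0 < n%:R :> R by rewrite ltr0n (ltn_trans _ n3).
(* Turns the error n / ((n - 1)(n - 2)) into at most 4 / n; this fails at n = 3, hence the
   hypothesis 3 < n. *)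
have nN : n%:R * n%:R <= 4%:R * (n.-1 * n.-2)%:R :> R.
  by rewrite -!natrM ler_nat; case: n n3 {D0 N0 n0} => [|[|[|[|n]]]] // _; lia.
rewrite ![(_ * 2)%:R]natrM ![(2 * _ * _)%:R]natrM ![(2 * _)%:R]natrM.
move: (ex_Q n F)%:R (n * 2 ^ n.-1)%:R (n.-1 * n.-2)%:R n%:R D0 N0 n0 nN
  => E D N m D0 N0 n0 nN ineq.
have b_neq0 : b%:R != 0 :> R by rewrite pnatr_eq0 -lt0n.
have A_neq0 : A != 0 by rewrite gt_eqF.
have {AB} -> : a%:R / b%:R = B / A.
  by apply/eqP; rewrite eqr_div // [X in _ == X]mulrC AB.
rewrite ler_pdivrMr // -(ler_pM2l A0) -(ler_pM2l N0).
apply: le_trans (_ : B * D * N + C * D * m <= _); first lra.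
have -> : N * (A * ((B / A + 4%:R * C / A / m) * D)) =
    B * D * N + C * D * (4%:R * N / m) by field; rewrite A_neq0 gt_eqF.
by rewrite lerD2l ler_wpM2l ?mulr_ge0 ?(ltW D0) // ler_pdivlMr.
Qed.

Lemma limn_ratio_Q_le (R : realType) (F : sgraph) (l c : R) :
  (forall n, (3 < n)%N -> ratio_Q R F n <= l + c * n%:R^-1) -> pi_Q R F <= l.
Proof.
move=> le_l.
(* The shift by one matches the harmonic sequence 1 / (n + 1). *)
have cl : ((fun n : nat => l + c * n.+1%:R^-1) @ \oo --> l)%classic.
  rewrite -[X in (_ --> X)%classic]addr0 -[X in _ + X](mulr0 c).
  by apply: cvgD; [exact: cvg_cst | apply: cvgM; [exact: cvg_cst | exact: cvg_harmonic]].
have cr : ((fun n => ratio_Q R F n.+1) @ \oo --> pi_Q R F)%classic.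
  by rewrite (cvg_shiftS (ratio_Q R F)); exact: ratio_Q_cvg.
rewrite -(cvg_lim _ cl) // -(cvg_lim _ cr) //.
apply: ler_lim; [by apply/cvg_ex; exists (pi_Q R F) | by apply/cvg_ex; exists l |].
by exists 3%N => // n /= n3; apply: le_l.
Qed.

Theorem theorem2 (R : realType) : pi_Q R (cycle_graph 6) <= 3755%:R / 10%:R ^+ 4.
Proof.
have A_gt0 : 0 < edge_weight by [].
have C_ge0 : 0 <= error_weight by [].
have AB : (10 ^ 4)%:R * bound_weight = 3755%:R * edge_weight.
  by rewrite natrX; apply: weight_ratio.
have b_gt0 : (0 < 10 ^ 4)%N by rewrite expn_gt0.
rewrite -natrX.
exact: limn_ratio_Q_le (ratio_Q_le_inv R A_gt0 C_ge0 AB b_gt0 ex_Q_bound).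
Qed.
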